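(* Let $J$ be a finite set with $m:=|J|\ge 3$, let $\Pi=(P_x)_{x\in J}$ be a partition of a finite set $P$ of participants, and let $\mathcal{Z}=(J,h,\boldsymbol g)$ be a uniform polymatroid with increment sequence $\boldsymbol g=(g_i)_{0\le i\le m}$ such that $g_0=g_{m-1}>0$ and $g_0<|P_x|$ for all $x\in J$. (1) A monotone increasing family $\Delta\subseteq\mathcal{P}(J)\setminus\{\emptyset\}$ is compatible with $\mathcal{Z}$ if and only if $\min\Delta=\{X\}$ for a certain $\emptyset\neq X\subseteq J$. (2) Let $\Delta\subseteq\mathcal{P}(J)\setminus\{\emptyset\}$ be a monotone increasing family such that $\min\Delta=\{X\}$ for a certain $\emptyset\ne X\subseteq J$, and let $\Gamma=\Gamma(\Pi,\mathcal{Z},\Delta)$. Then (2a) the vector $\sum_{x\in X}g_0\,\bar e^{(x)}$ is the only minimal authorized vector in the access structure $\Gamma$, where $\bar e^{(x)}\in\mathbb{N}_0^J$ is the vector with $x$-coordinate $1$ and all other coordinates $0$; (2b) the hierarchical preorder induced by $\Gamma$ on $\Pi$ is of the type $Ord^*(J\setminus X,X)$.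
   Context: Polymatroids. For a finite set $J$ let $\mathcal{P}(J)$ be its power set. An (integer) polymatroid is a pair $(J,h)$ with $h:\mathcal{P}(J)\to\mathbb{N}_0$ such that $h(\emptyset)=0$, $h(X)\le h(Y)$ if $X\subseteq Y$, and $h(X\cap Y)+h(X\cup Y)\le h(X)+h(Y)$. It is uniform if $h(X)=h(Y)$ whenever $|X|=|Y|$; write $h_i=h(X)$ for $|X|=i$. With $m=|J|$, its increment sequence is $\boldsymbol g=(g_0,\dots,g_m)$, $g_i=h_{i+1}-h_i$ for $0\le i\le m-1$ and $g_m=0$; it is a nonincreasing sequence of nonnegative integers, and $g_0>0$ is assumed. Such a polymatroid is written $\mathcal{Z}=(J,h,\boldsymbol g)$. Compatibility. A monotone increasing family $\Delta\subseteq\mathcal{P}(J)\setminus\{\emptyset\}$ is a nonempty family of nonempty subsets of $J$ closed under taking supersets in $J$; $\min\Delta$ is the set of its inclusion-minimal members. Fix $x_0\notin J$ and define $h'$ on $\mathcal{P}(J\cup\{x_0\})$ by $h'(X)=h(X)$ for $X\subseteq J$, $h'(X\cup\{x_0\})=h(X)$ if $X\in\Delta$, and $h'(X\cup\{x_0\})=h(X)+1$ if $X\subseteq J$, $X\notin\Delta$. $\Delta$ is compatible with $\mathcal{Z}$ if $h'$ is monotone increasing and submodular. Access structure. A partition $\Pi=(P_x)_{x\in J}$ of $P$ consists of pairwise disjoint nonempty sets (blocks) with union $P$. For $A\subseteq P$ put $\pi(A)=(|A\cap P_x|)_{x\in J}\in\mathbb{N}_0^J$. For $\bar v\in\mathbb{N}_0^J$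 and $Y\subseteq J$ put $\mathrm{supp}(\bar v)=\{x:v_x\ne0\}$, $|\bar v|=\sum_{x\in J}v_x$, $|\bar v_Y|=\sum_{x\in Y}v_x$. For $X\subseteq J$ let $\mathcal{B}(\mathcal{Z},X)=\{\bar v\in\mathbb{N}_0^J:\mathrm{supp}(\bar v)\subseteq X,\ |\bar v|=h(X),\ |\bar v_Y|\le h(Y)\text{ for all }Y\subseteq X\}$. For $\Delta$ compatible with $\mathcal{Z}$, $\Gamma(\Pi,\mathcal{Z},\Delta)$ is the family of all $A\subseteq P$ such that $\pi(A)\ge\bar v$ (coordinatewise) for some $\bar v\in\bigcup_{X\in\Delta}\mathcal{B}(\mathcal{Z},X)$. The authorized vectors of $\Gamma$ are the vectors $\pi(A)$ with $A\in\Gamma$; minimal authorized vectors are the minimal ones with respect to the coordinatewise order. Hierarchy. For participants $p,q\in P$ write $q\preccurlyeq p$ if $A\cup\{p\}\in\Gamma$ for all $A\subseteq P\setminus\{p,q\}$ with $A\cup\{q\}\in\Gamma$. For blocks, $P_y\preccurlyeq P_x$ means $q\preccurlyeq p$ for some (equivalently, all) $q\in P_y$, $p\in P_x$; this is a preorder on $\Pi$. For disjoint $Y,X\subseteq J$, the preorder $\preccurlyeq$ on $\Pi$ is of type $Ord^*(Y,X)$ if for all $a,b\in J$: $P_b\preccurlyeq P_a$ if and only if ($a=b$) or ($a,b\in Y$) or ($b\in Y$ and $a\in X$). *)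

(* Defs.v *)
From mathcomp Require Import all_boot all_order all_algebra.

Set Implicit Arguments.
Unset Strict Implicit.
Unset Printing Implicit Defensive.

Section Polymatroid.

Variable J : finType.
Implicit Types (h : {set J} -> nat) (X Y : {set J}).

Definition monotone h := forall X Y, X \subset Y -> h X <= h Y.

Definition submodular h :=
  forall X Y, h (X :&: Y) + h (X :|: Y) <= h X + h Y.

Definition polymatroid h := [/\ h set0 = 0, monotone h & submodular h].

Definition uniform h := forall X Y, #|X| = #|Y| -> h X = h Y.

(* The equation g_i = h_{i+1} - h_i is stated additively, so that no truncated
   subtraction occurs.  Every i <= #|J| is the cardinal of some X, so g is
   entirely determined by a uniform h. *)
Definition increment_seq h (g : (#|J|.+1).-tuple nat) :=
  (forall X Y, #|Y| = #|X|.+1 -> h Y = h X + nth 0 g #|X|) /\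
  nth 0 g #|J| = 0.

Definition increasing_family (D : {set {set J}}) :=
  [/\ D != set0, set0 \notin D &
      forall X Y, X \in D -> X \subset Y -> Y \in D].

Definition min_family (D : {set {set J}}) : {set {set J}} :=
  [set X | minset [in D] X].

End Polymatroid.

(* J together with the new point x_0 is option J: x_0 is None, and the
   trace on J of Z : {set option J} is Some @^-1: Z. *)
Definition extension (J : finType) (h : {set J} -> nat) (D : {set {set J}})
    (Z : {set option J}) : nat :=
  let X := Some @^-1: Z in
  if (None \in Z) && (X \notin D) then h X + 1 else h X.

Definition compatible (J : finType) (h : {set J} -> nat) (D : {set {set J}}) :=
  monotone (extension h D) /\ submodular (extension h D).

Section Vectors.

Variable J : finType.
Implicit Types (v w : {ffun J -> nat}) (X Y : {set J}).

Definition vec_le v w := forall x, v x <= w x.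

Definition unit_vec (x : J) : {ffun J -> nat} := [ffun y => nat_of_bool (y == x)].

Definition in_base (h : {set J} -> nat) X v :=
  [/\ 0.-support v \subset X,
      \sum_(x : J) v x = h X &
      forall Y, Y \subset X -> \sum_(x in Y) v x <= h Y].

End Vectors.

Section AccessStructure.

Variables J P : finType.
Implicit Types (Pi : J -> {set P}) (A : {set P}) (v w : {ffun J -> nat}).

Definition block_partition Pi :=
  [/\ forall x, Pi x != set0,
      forall x y, x != y -> [disjoint Pi x & Pi y] &
      \bigcup_(x : J) Pi x = [set: P]].

Definition profile Pi A : {ffun J -> nat} := [ffun x => #|A :&: Pi x|].

Definition access Pi (h : {set J} -> nat) (D : {set {set J}}) A : Prop :=
  exists X v, [/\ X \in D, in_base h X v & vec_le v (profile Pi A)].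

Variable Gamma : {set P} -> Prop.

Definition authorized_vec Pi v := exists2 A, Gamma A & v = profile Pi A.

Definition minimal_authorized_vec Pi v :=
  authorized_vec Pi v /\
  forall w, authorized_vec Pi w -> vec_le w v -> w = v.

Definition hier_le (q p : P) :=
  forall A, A \subset ~: [set p; q] -> Gamma (q |: A) -> Gamma (p |: A).

Definition block_le Pi (y x : J) :=
  exists q p, [/\ q \in Pi y, p \in Pi x & hier_le q p].

Definition type_Ord_star Pi (Y X : {set J}) :=
  [disjoint Y & X] /\
  forall a b : J, block_le Pi b a <->
    [\/ a = b, (a \in Y) /\ (b \in Y) | (b \in Y) /\ (a \in X)].

End AccessStructure.

(* Main.v *)
(** Comparing the first and the last increment through submodularity shows that
    [h X = g_0 * #|X|], so [h] is modular.  Hence the extension by [x_0] is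
    submodular only if D is closed under intersection, that is, consists of all
    supersets of one set X.  The only base of X is then [g_0] on X and [0]
    elsewhere, and A is authorized iff it meets every block indexed by X in at
    least [g_0] participants. *)
Require Import Defs.
From mathcomp Require Import all_boot all_order all_algebra.
From mathcomp Require Import zify.

Set Implicit Arguments.
Unset Strict Implicit.
Unset Printing Implicit Defensive.

(** Grown one element at a time; it later selects [c] or [c.-1] participants of a block. *)
Lemma subset_of_card (T : finType) (B : {set T}) (n : nat) :
  n <= #|B| -> exists2 A : {set T}, A \subset B & #|A| = n.
Proof.
elim: n => [|n IHn] ltnB; first by exists set0; rewrite ?sub0set ?cards0.
have [A sAB cA] := IHn (ltnW ltnB).
have /properP[_ [x xB xA]]: A \proper B by rewrite properEcard sAB cA.
by exists (x |: A); rewrite ?subUset ?sub1set ?xB // cardsU1 xA cA.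
Qed.

Definition trace (J : finType) (Z : {set option J}) : {set J} := Some @^-1: Z.

Lemma extensionE (J : finType) (h : {set J} -> nat) (D : {set {set J}})
    (Z : {set option J}) :
  extension h D Z = h (trace Z) + ((None \in Z) && (trace Z \notin D)).
Proof. by rewrite /extension -/(trace Z); case: ifP; rewrite ?addn0. Qed.

(** * Rank proportional to cardinality: bases and compatible families *)

Section LinearPolymatroid.

Variables (J : finType) (h : {set J} -> nat).

(* Submodularity at (x |: X, J \ x) bounds the increment at x below by the last
   one, and at (X, [set x]) it bounds it above by the first one. *)
Lemma rank_linear (g : (#|J|.+1).-tuple nat) :
  polymatroid h -> increment_seq h g ->
  nth 0 g 0 = nth 0 g (#|J| - 1) ->
  forall X : {set J}, h X = nth 0 g 0 * #|X|.
Proof.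
move=> [h0 _ subm] [incr _] eg X.
have h1 x : h [set x] = nth 0 g 0.
  by rewrite (incr set0) ?cards0 ?cards1 // h0.
have hT x : h setT = h (setT :\ x) + nth 0 g 0.
  have := cardsD1 x setT; rewrite in_setT cardsT => cT.
  rewrite (incr (setT :\ x)) ?cardsT; last by lia.
  by congr (_ + _); rewrite eg; congr (nth 0 g); lia.
have step x (Y : {set J}) : x \notin Y -> h (x |: Y) = h Y + nth 0 g 0.
  move=> xY; have up := subm [set x] Y.
  have lo := subm (x |: Y) (setT :\ x).
  have eI: (x |: Y) :&: (setT :\ x) = Y.
    apply/setP=> y; rewrite !inE andbT.
    by case: eqVneq => [->|]; rewrite ?(negbTE xY) ?andbT.
  have eU: (x |: Y) :|: (setT :\ x) = setT.
    by apply/setP=> y; rewrite !inE andbT; case: eqVneq; rewrite ?orbT.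
  by move: up lo; rewrite eI eU (hT x) h1; lia.
have [n] := ubnP #|X|; elim: n X => // n IHn X.
have [->|[x xX]] := set_0Vmem X; first by rewrite h0 cards0 muln0.
have := cardsD1 x X; rewrite xX => cX leX.
by rewrite -(setD1K xX) step ?setD11 // setD1K // IHn; lia.
Qed.

Variable c : nat.
Hypothesis hE : forall X : {set J}, h X = c * #|X|.

Lemma rank_modular (X Y : {set J}) : h (X :&: Y) + h (X :|: Y) = h X + h Y.
Proof. by rewrite !hE; have := cardsUI X Y; nia. Qed.

(** The bounds on singletons give [v x <= c] on [X], and the total [c * #|X|] leaves no slack in any
    of them. Conversely, this vector sums to [c * #|Y :&: X|] over every [Y]. *)
Lemma in_baseP (X : {set J}) (v : {ffun J -> nat}) :
  in_base h X v <-> v = [ffun x => c * (x \in X)].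
Proof.
split=> [[/subsetP supp tot sub]|->].
  have v_le x : x \in X -> v x <= c.
    by move=> xX; have := sub [set x]; rewrite sub1set xX big_set1 hE cards1
      muln1; apply.
  have v0 x : x \notin X -> v x = 0.
    by move=> xX; apply/eqP; apply: contraNT xX => vx; exact: supp.
  have totX: \sum_(x in X) v x = \sum_(x in X) c.
    rewrite sum_nat_const mulnC -hE -tot [RHS](bigID [in X]) /=.
    by rewrite [X in _ + X]big1 ?addn0.
  have /leqif_sum eqif: forall x, x \in X -> v x <= c ?= iff (v x == c).
    by move=> x xX; split; rewrite ?v_le.
  move: (eqif.2); rewrite totX eqxx => /esym/forall_inP vc.
  apply/ffunP=> x; rewrite ffunE; case: (boolP (x \in X)) => xX.
    by rewrite muln1; apply/eqP/vc.
  by rewrite muln0 v0.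
have sumE (Y : {set J}) : \sum_(x in Y) [ffun x => c * (x \in X)] x
    = c * #|Y :&: X|.
  under eq_bigr do rewrite ffunE.
  rewrite -big_distrr /= -sum1_card big_mkcond [in RHS]big_mkcond /=.
  by congr (_ * _); apply: eq_bigr => x _; rewrite inE; do 2!case: (x \in _).
split.
- by apply/subsetP=> x; rewrite inE ffunE; case: (x \in X); rewrite ?muln0.
- by have := sumE setT; rewrite setTI hE => <-; apply: eq_bigl => x; rewrite inE.
- by move=> Y sYX; rewrite sumE hE (setIidPl sYX).
Qed.

(** Adjoin [None] to [X] and [Y]. If [X :&: Y] were outside [D], the extension would exceed [h] by
    one on the intersection and agree with [h] on both sets and their union, so modularity of [h]
    would break submodularity. *)
Lemma compatible_setI (D : {set {set J}}) (X Y : {set J}) :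
  compatible h D -> (forall A B : {set J}, A \in D -> A \subset B -> B \in D) ->
  X \in D -> Y \in D -> X :&: Y \in D.
Proof.
move=> [_ subm] up XD YD; apply: contraT => XYD.
have [Z NZ traceZ] : exists2 Z : {set J} -> {set option J},
    forall A, None \in Z A & forall A, trace (Z A) = A.
  exists (fun A : {set J} => None |: [set Some x | x in A]) => A.
    by rewrite !inE.
  by apply/setP=> x; rewrite !inE /= mem_imset //; exact: Some_inj.
have := subm (Z X) (Z Y); rewrite !extensionE /trace preimsetI preimsetU.
rewrite -!/(trace _) !traceZ.
rewrite in_setI in_setU !NZ /= XD YD XYD /=.
by rewrite (up X) ?subsetUl //=; have := rank_modular X Y; lia.
Qed.

Hypothesis c_gt0 : 0 < c.

(** As [h] is modular, submodularity only concerns the extra unit, and [X] lies in an intersection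
    exactly when it lies in both traces. *)
Lemma compatible_principal (D : {set {set J}}) (X : {set J}) :
  (forall A : {set J}, (A \in D) = (X \subset A)) -> compatible h D.
Proof.
move=> DE; have ext Z : extension h D Z
    = h (trace Z) + ((None \in Z) && ~~ (X \subset trace Z)).
  by rewrite extensionE DE.
split=> Z W.
  move=> sZW; have sT : trace Z \subset trace W by exact: preimsetS.
  have NZW : None \in Z -> None \in W by exact: (subsetP sZW).
  rewrite !ext !hE; have [le_card eq_card] := subset_leqif_cards sT.
  have le_c := leq_mul (leqnn c) le_card.
  case: (boolP (None \in Z)) NZW => [_ /(_ isT) -> | _ _] /=; last by lia.
  case: (boolP (X \subset trace Z)) => XZ /=; first by rewrite (subset_trans XZ sT); lia.
  case: (boolP (X \subset trace W)) => XW /=; last by lia.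
  (* The only case where the extra unit is lost: the trace grows strictly, so [h] gains at least
     [c], which is positive and pays for it. *)
  have : trace Z != trace W by apply: contraNneq XZ => ->.
  by rewrite -eq_card; nia.
rewrite !ext /trace preimsetI preimsetU -/(trace Z) -/(trace W) subsetI in_setI in_setU.
have := rank_modular (trace Z) (trace W).
have : X \subset trace Z -> X \subset trace Z :|: trace W.
  by move=> XZ; exact: subset_trans XZ (subsetUl _ _).
have : X \subset trace W -> X \subset trace Z :|: trace W.
  by move=> XW; exact: subset_trans XW (subsetUr _ _).
by do 2!case: (None \in _); do 3!case: (X \subset _) => //=;
  do 2?[move=> /(_ isT) // | move=> _]; lia.
Qed.

End LinearPolymatroid.

(** By finiteness every member of [D] contains a minimal one, so a single minimal member generates
    the whole up-set. *)
Lemma min_familyP (J : finType) (D : {set {set J}}) (X : {set J}) :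
  increasing_family D ->
  min_family D = [set X] <-> (forall A : {set J}, (A \in D) = (X \subset A)).
Proof.
move=> [_ _ up]; split=> [minX A | DE].
  have /minsetP[XD _] : minset [in D] X.
    by have := set11 X; rewrite -minX inE.
  apply/idP/idP => [AD | ]; last exact: up XD.
  have [B minB sBA] := minset_exists (P := [in D]) AD.
  suff /set1P<- : B \in [set X] by [].
  by rewrite -minX inE.
apply/setP=> A; rewrite !inE; apply/minsetP/eqP => [[]|->].
  by rewrite /= DE => XA minA; rewrite (minA X) ?DE.
by split=> [|B]; rewrite /= DE // => XB BX; apply/eqP; rewrite eqEsubset BX.
Qed.

(** * Access structure of a family generated by one set *)

Section PrincipalAccess.

Variables (J P : finType) (Pi : J -> {set P}) (h : {set J} -> nat) (c : nat).
Variables (D : {set {set J}}) (X : {set J}).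
Hypothesis partPi : block_partition Pi.
Hypothesis hE : forall Y : {set J}, h Y = c * #|Y|.
Hypothesis DE : forall Y : {set J}, (Y \in D) = (X \subset Y).

Lemma block_inj x y p : p \in Pi x -> p \in Pi y -> x = y.
Proof.
case: partPi => _ disj _ px py; case: (eqVneq x y) => // /disj.
by move/disjoint_setI0/setP/(_ p); rewrite !inE px py.
Qed.

(** Each [Y] in [D] has a single base vector, and since [Y] contains [X] the weakest demand is the
    one for [X] itself. *)
Lemma accessP (A : {set P}) :
  access Pi h D A <-> (forall x, x \in X -> c <= #|A :&: Pi x|).
Proof.
split=> [[Y [v [+ /(in_baseP hE) -> le_v]]] x xX | leA].
  rewrite DE => /subsetP/(_ _ xX) xY; have := le_v x.
  by rewrite !ffunE xY muln1.
exists X, [ffun x => c * (x \in X)]; split; first by rewrite DE.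
  by apply/(in_baseP hE).
by move=> x; rewrite !ffunE; case: (boolP (x \in X)) => [/leA|]; rewrite ?muln1 ?muln0.
Qed.

(** The vector [w] is below every authorized vector, and it is realized by taking exactly [c]
    participants from each block of [X]; a least element is the only minimal one. *)
Lemma minimal_authorizedP (v : {ffun J -> nat}) :
  (forall x, c <= #|Pi x|) ->
  minimal_authorized_vec (access Pi h D) Pi v <->
  v = [ffun x => c * (x \in X)].
Proof.
move=> le_c; set w := [ffun x => c * (x \in X)].
have w_min u : authorized_vec (access Pi h D) Pi u -> vec_le w u.
  move=> [A /accessP leA ->] x; rewrite !ffunE.
  by case: (boolP (x \in X)) => [/leA|]; rewrite ?muln1 ?muln0.
have w_auth : authorized_vec (access Pi h D) Pi w.
  have /fin_all_exists2[B sB cB] x := subset_of_card (le_c x).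
  have AE y : (\bigcup_(x in X) B x) :&: Pi y = if y \in X then B y else set0.
    apply/setP=> p; rewrite !inE; apply/andP/idP => [[/bigcupP[x xX pB] py]|].
      by rewrite -(@block_inj x y p) ?xX // (subsetP (sB x)).
    case: ifP => [yX pB|]; last by rewrite inE.
    by split; [apply/bigcupP; exists y | exact: (subsetP (sB y))].
  exists (\bigcup_(x in X) B x).
    by apply/accessP=> x xX; rewrite AE xX cB.
  apply/ffunP=> x; rewrite !ffunE AE.
  by case: ifP; rewrite ?cB ?cards0 ?muln1 ?muln0.
split=> [[v_auth v_min]|->]; first by rewrite (v_min w) //; exact: w_min.
split=> // u /w_min wu uw; apply/ffunP=> x.
by apply/eqP; rewrite eqn_leq uw wu.
Qed.

(** Access counts participants in the blocks of [X] only, so those of other blocks lie below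
    everyone. If [b] is in [X] and [a] differs from [b], a set lacking one participant in [Pi b] is
    completed by [q] but not by [p]. *)
Lemma access_Ord_star :
  0 < c -> (forall x, c < #|Pi x|) ->
  type_Ord_star (access Pi h D) Pi (~: X) X.
Proof.
move=> c_gt0 lt_c; have nonempty x : exists p, p \in Pi x.
  by apply/set0Pn; case: partPi.
split; first by rewrite disjoint_sym disjoints_subset setCK.
move=> a b; split=> [[q [p [qb pa qp]]] | ]; last first.
  have [p pa] := nonempty a; have [q qb] := nonempty b.
  have [<- _|ne_ab ord] := eqVneq a b; first by exists p, p; split=> // A.
  have bX : b \notin X.
    by case: ord => [/eqP||]; rewrite ?(negbTE ne_ab) // !inE; case.
  exists q, p; split=> // A _ /accessP qA; apply/accessP=> x xX.
  apply: leq_trans (qA x xX) (subset_leq_card _); apply/subsetP=> r.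
  rewrite !inE => /andP[/predU1P[->|->] rx]; last by rewrite orbT.
  by move: xX; rewrite -(@block_inj b x q) ?(negbTE bX).
have [->|ne_ab] := eqVneq a b; first by constructor 1.
have [bX|bX] := boolP (b \in X); last first.
  by case: (boolP (a \in X)) => aX; [constructor 3 | constructor 2]; rewrite !inE bX.
(* Since [c] is positive, adding [q] to [c.-1] other participants of [Pi b] gives exactly [c]. *)
have le_b : c.-1 <= #|Pi b :\ q|.
  by have := cardsD1 q (Pi b); rewrite qb; have := lt_c b; lia.
have [B sB cB] := subset_of_card le_b.
(* A has one participant too few in Pi b, and everyone but p outside Pi b. *)
pose A := (~: Pi b :\ p) :|: B.
have pb : p \notin Pi b.
  by apply/negP=> pb; move: ne_ab; rewrite (@block_inj a b p) ?eqxx.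
have Ab : A :&: Pi b = B.
  apply/setP=> r; rewrite !inE; have := subsetP sB r; rewrite !inE.
  by case: (r \in B) => [/(_ isT)/andP[_ ->]|_]; rewrite ?orbT ?orbF //; 
    case: (r \in Pi b); rewrite ?andbF.
have pB : p \notin B by apply: contra pb => /(subsetP sB); rewrite inE => /andP[].
have qB : q \notin B by apply/negP=> /(subsetP sB); rewrite !inE eqxx.
have sA : A \subset ~: [set p; q].
  apply/subsetP=> r; rewrite !inE negb_or => /orP[/andP[-> rb]|rB] /=.
    by apply: contraNneq rb => ->.
  by apply/andP; split; [apply: contraNneq pB | apply: contraNneq qB] => <-.
have /accessP/(_ b bX) : access Pi h D (p |: A).
  apply: qp => //; apply/accessP=> x xX; have [->|ne_xb] := eqVneq x b.
    have -> : (q |: A) :&: Pi b = q |: B.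
      by rewrite setIUl Ab; congr (_ :|: _); apply/setIidPl; rewrite sub1set.
    by rewrite cardsU1 qB cB; lia.
  (* The strict bound [c < #|Pi x|] is what allows [p] to be removed from its own block. *)
  have le_x : c <= #|Pi x :\ p|.
    by have := cardsD1 p (Pi x); have := lt_c x; case: (p \in _); lia.
  apply: leq_trans le_x (subset_leq_card _); apply/subsetP=> r.
  rewrite !inE => /andP[-> rx]; rewrite rx /= andbT.
  suff -> : r \notin Pi b by rewrite orbT.
  by apply/negP=> rb; move: ne_xb; rewrite (@block_inj x b r) ?eqxx.
rewrite setIUl Ab; have -> : [set p] :&: Pi b = set0.
  by apply/disjoint_setI0; rewrite disjoints1.
by rewrite set0U cB; lia.
Qed.

End PrincipalAccess.

(** * Sums of unit vectors and the final assembly *)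

Lemma sum_unit_vec (J : finType) (X : {set J}) (n : nat) :
  (\sum_(x in X) unit_vec x *+ n)%R = [ffun x => n * (x \in X)].
Proof.
apply/ffunP=> y; rewrite sum_ffunE !ffunE.
have E x : ((unit_vec x *+ n)%R : {ffun J -> nat}) y = n * (y == x).
  by elim: n => [|n IHn]; rewrite ?ffunE // GRing.mulrS ffunE IHn ffunE mulSn.
under eq_bigr do rewrite E.
case: (boolP (y \in X)) => yX.
  rewrite (bigD1 y) //= eqxx big1 ?GRing.addr0 // => x /andP[_ /negbTE].
  by rewrite eq_sym => ->; rewrite muln0.
by rewrite big1 ?muln0 // => x xX; case: eqVneq yX => [->|]; rewrite ?xX ?muln0.
Qed.

Theorem theorem4p8 (J P : finType) (Pi : J -> {set P})
    (h : {set J} -> nat) (g : (#|J|.+1).-tuple nat) :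
  3 <= #|J| ->
  block_partition Pi ->
  polymatroid h -> uniform h -> increment_seq h g ->
  nth 0 g 0 = nth 0 g (#|J| - 1) -> 0 < nth 0 g 0 ->
  (forall x : J, nth 0 g 0 < #|Pi x|) ->
  (forall D : {set {set J}}, increasing_family D ->
     (compatible h D <->
      exists X : {set J}, X != set0 /\ min_family D = [set X])) /\
  (forall (D : {set {set J}}) (X : {set J}),
     increasing_family D -> X != set0 -> min_family D = [set X] ->
     (forall v : {ffun J -> nat},
        minimal_authorized_vec (access Pi h D) Pi v <->
        v = (\sum_(x in X) unit_vec x *+ nth 0%N g 0)%R) /\
     type_Ord_star (access Pi h D) Pi (~: X) X).
Proof.
move=> _ partPi poly _ incr eg g_gt0 lt_g.
have hE := rank_linear poly incr eg.
split=> [D incD | D X incD _ /(min_familyP _ incD) DE]; last first.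
  split=> [v|]; last exact: access_Ord_star hE DE g_gt0 lt_g.
  rewrite sum_unit_vec; apply: minimal_authorizedP => // x.
  exact: ltnW.
split=> [compD | [X [_ /(min_familyP _ incD) DE]]]; last first.
  exact: (compatible_principal hE g_gt0 DE).
have [/set0Pn[A AD] D0 up] := incD.
have [X /minsetP[/= XD minX] _] := minset_exists (P := [in D]) AD.
exists X; split; first by apply: contraNneq D0 => <-.
apply/min_familyP => // B; apply/idP/idP => [BD|]; last exact: up XD.
(* Once [X :&: B] is known to be in [D], minimality of [X] makes it equal to [X], so [X] lies in
   [B]. *)
apply/setIidPl/minX; last exact: subsetIl.
exact: (compatible_setI hE compD up XD BD).
Qed.
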